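(* Let $\sigma$ be a relational signature and let $\varphi(\bar x)$ be a first-order $\sigma$-formula belonging to $\Sigma_n$, with $m:=|\bar x|>0$. Then $\mathrm{lr}(\varphi)<(2\|\varphi\|+1)^n$.
   Context: Structures are finite with non-empty universe. $\Sigma_n$ is the set of first-order formulas of quantifier alternation depth at most $n$ whose outermost quantifier block is existential. $\|\varphi\|$ is the length of $\varphi$ as a word. The Gaifman graph of $\mathcal{A}$ has vertex set $A$ and an edge between distinct elements occurring together in a tuple of some relation. For a tuple $\bar a$, $N_r^{\mathcal{A}}(\bar a)$ is the set of elements at Gaifman distance $\le r$ from an entry of $\bar a$, and the $r$-sphere of $\bar a$ is the induced substructure on $N_r^{\mathcal{A}}(\bar a)$ with distinguished tuple $\bar a$. For $\bar a\in A^k$, $\bar b\in B^k$, $(\mathcal{A},\bar a)$ and $(\mathcal{B},\bar b)$ are $r$-equivalent if there is a bijection $f:A\to B$ such that for all $c\in A$ the $r$-spheres of $(\bar a,c)$ in $\mathcal{A}$ and of $(\bar b,f(c))$ in $\mathcal{B}$ are isomorphic (respecting distinguished tuples). $\varphi(\bar x)$ with $k$ free variables is Hanf-local if some $r\ge0$ satisfies: whenever $(\mathcal{A},\bar a)$ and $(\mathcal{B},\bar b)$ are $r$-equivalent, $\mathcal{A}\models\varphi[\bar a]\iff\mathcal{B}\models\varphi[\bar b]$; the least such $r$ is the Hanf-locality rank $\mathrm{lr}(\varphi)$. *)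

(* Defs.v *)
From mathcomp Require Import all_boot.
Unset Printing Implicit Defensive.

Record signature := Signature { sym : Type; ar : sym -> nat }.
Arguments ar {s} _.

Inductive formula (sg : signature) : Type :=
| FEq : nat -> nat -> formula sg
| FRel : forall s : sym sg, (ar s).-tuple nat -> formula sg
| FNot : formula sg -> formula sg
| FAnd : formula sg -> formula sg -> formula sg
| FOr : formula sg -> formula sg -> formula sg
| FEx : nat -> formula sg -> formula sg
| FAll : nat -> formula sg -> formula sg.

Arguments FEq {sg}. Arguments FRel {sg}. Arguments FNot {sg}.
Arguments FAnd {sg}. Arguments FOr {sg}. Arguments FEx {sg}. Arguments FAll {sg}.

Fixpoint free_in (sg : signature) (v : nat) (phi : formula sg) : bool :=
  match phi with
  | FEq x y => (v == x) || (v == y)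
  | FRel _ t => v \in (t : seq nat)
  | FNot p => free_in sg v p
  | FAnd p q | FOr p q => free_in sg v p || free_in sg v q
  | FEx x p | FAll x p => (v != x) && free_in sg v p
  end.

(* Length of the formula written as a word over the alphabet of variables,
   relation symbols, '=', '¬', '∧', '∨', '∃', '∀', '(', ')', ','.
   R(x1,...,xk) has length 2k+2 (k>=1), a nullary atom R has length 1;
   x=y has length 3; ¬φ: 1+|φ|; (φ∧ψ),(φ∨ψ): 3+|φ|+|ψ|; ∃xφ,∀xφ: 2+|φ|. *)
Fixpoint flen (sg : signature) (phi : formula sg) : nat :=
  match phi with
  | FEq _ _ => 3
  | FRel s _ => if ar s is 0 then 1 else (ar s).*2 + 2
  | FNot p => 1 + flen sg p
  | FAnd p q | FOr p q => 3 + flen sg p + flen sg q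
  | FEx _ p | FAll _ p => 2 + flen sg p
  end.

Fixpoint qfree (sg : signature) (phi : formula sg) : bool :=
  match phi with
  | FEq _ _ | FRel _ _ => true
  | FNot p => qfree sg p
  | FAnd p q | FOr p q => qfree sg p && qfree sg q
  | FEx _ _ | FAll _ _ => false
  end.

Arguments free_in {sg}. Arguments flen {sg}. Arguments qfree {sg}.

Inductive SigmaF {sg} : nat -> formula sg -> Prop :=
| Sig_qf n phi : qfree phi -> SigmaF n phi
| Sig_Pi n phi : PiF n phi -> SigmaF n.+1 phi
| Sig_not n phi : PiF n phi -> SigmaF n (FNot phi)
| Sig_and n p q : SigmaF n p -> SigmaF n q -> SigmaF n (FAnd p q)
| Sig_or n p q : SigmaF n p -> SigmaF n q -> SigmaF n (FOr p q)
| Sig_ex n x p : SigmaF n p -> n > 0 -> SigmaF n (FEx x p)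
with PiF {sg} : nat -> formula sg -> Prop :=
| Pi_qf n phi : qfree phi -> PiF n phi
| Pi_Sig n phi : SigmaF n phi -> PiF n.+1 phi
| Pi_not n phi : SigmaF n phi -> PiF n (FNot phi)
| Pi_and n p q : PiF n p -> PiF n q -> PiF n (FAnd p q)
| Pi_or n p q : PiF n p -> PiF n q -> PiF n (FOr p q)
| Pi_all n x p : PiF n p -> n > 0 -> PiF n (FAll x p).

Record structure (sg : signature) := Structure {
  dom :> finType;
  inh : dom;
  rel : forall s : sym sg, (ar s).-tuple dom -> bool }.

Arguments inh {sg}. Arguments rel {sg}.

Fixpoint sat (sg : signature) (A : structure sg) (phi : formula sg) (e : nat -> A) {struct phi} : Prop :=
  match phi with
  | FEq x y => e x = e y
  | FRel s t => rel A s (map_tuple e t)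
  | FNot p => ~ sat sg A p e
  | FAnd p q => sat sg A p e /\ sat sg A q e
  | FOr p q => sat sg A p e \/ sat sg A q e
  | FEx x p => exists a : A, sat sg A p (fun v => if v == x then a else e v)
  | FAll x p => forall a : A, sat sg A p (fun v => if v == x then a else e v)
  end.

Arguments sat {sg}.

Definition env {sg} (A : structure sg) (xs : seq nat) (a : seq A) : nat -> A :=
  fun v => nth (inh A) a (index v xs).

Definition gadj {sg} (A : structure sg) (x y : A) : Prop :=
  x <> y /\ exists (s : sym sg) (t : (ar s).-tuple A),
    rel A s t /\ x \in (t : seq A) /\ y \in (t : seq A).

Fixpoint within (sg : signature) (A : structure sg) (r : nat) (y x : A) : Prop :=
  match r with
  | 0 => x = y
  | r'.+1 => within sg A r' y x \/ exists z, within sg A r' y z /\ gadj A z x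
  end.

Arguments within {sg}.

Definition inN {sg} (A : structure sg) (r : nat) (a : seq A) (x : A) : Prop :=
  exists y, y \in a /\ within A r y x.

Definition sphere_iso {sg} (A B : structure sg) (r : nat) (a : seq A) (b : seq B)
  : Prop :=
  exists h : A -> B,
    [/\ (forall x, inN A r a x -> inN B r b (h x)),
        (forall x y, inN A r a x -> inN A r a y -> h x = h y -> x = y),
        (forall y, inN B r b y -> exists2 x, inN A r a x & h x = y),
        map h a = b &
        (forall (s : sym sg) (t : (ar s).-tuple A),
           (forall x, x \in (t : seq A) -> inN A r a x) ->
           (rel A s t <-> rel B s (map_tuple h t)))].

Definition r_equiv {sg} (A B : structure sg) (r : nat) (a : seq A) (b : seq B)
  : Prop :=
  exists f : A -> B, bijective f /\
    forall c : A, sphere_iso A B r (rcons a c) (rcons b (f c)).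

Definition hanf_local_with {sg} (phi : formula sg) (xs : seq nat) (r : nat)
  : Prop :=
  forall (A B : structure sg) (a : seq A) (b : seq B),
    size a = size xs -> size b = size xs -> r_equiv A B r a b ->
    (sat A phi (env A xs a) <-> sat B phi (env B xs b)).

Definition is_lr {sg} (phi : formula sg) (xs : seq nat) (r : nat) : Prop :=
  hanf_local_with phi xs r /\ forall r', r' < r -> ~ hanf_local_with phi xs r'.

(* Main.v *)
From mathcomp Require Import all_boot perm.
From mathcomp Require Import boolp zify.
Require Import Defs.

(** Suppose the base tuples of A and B are R-equivalent and k points are added in A.
    Group the points into clusters linked at distance 4r+2, the base tuple counting
    as one point; each cluster then lies within k(4r+2) of the base tuple or of one
    of its members. If R >= k(4r+2) + 3r+1, transporting each cluster along the sphere
    isomorphism of its anchor shows that A and B have equally many k-tuples whose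
    clusters separately have prescribed (3r+1)-spheres. Among these, the tuples in which
    two prescribed clusters interact have fewer clusters, so by induction they are
    equally numerous in A and B, hence so are the tuples with exactly the prescribed
    clusters. An answer in B of this kind makes the extended tuples r-equivalent, because
    a bijection preserving r-spheres of single points can be corrected, by transpositions,
    to agree with the cluster isomorphisms near the tuples.

    Thus a whole existential block with k quantifiers, with 2k < |phi|, costs
    r + 1 |-> (2|phi|+1)(r+1), which iterated n times from r = 0 gives the bound. *)

Set Implicit Arguments.
Unset Strict Implicit.

(** * Gaifman distance *)

Section Within.
Variables (sg : signature) (A : structure sg).

Lemma gadj_sym (x y : A) : gadj A x y -> gadj A y x.
Proof.
by case=> xy [s [t [rt [xt yt]]]]; split; [exact: nesym | exists s, t].
Qed.

Lemma within_mono r r' (y x : A) : r <= r' -> within A r y x -> within A r' y x.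
Proof.
elim: r' => [|r' IH]; first by rewrite leqn0 => /eqP->.
by rewrite leq_eqVlt => /orP[/eqP-> //|lt_r] wyx; left; apply: IH.
Qed.

Lemma within_refl r (x : A) : within A r x x.
Proof. exact: (@within_mono 0). Qed.

Lemma within_trans r r' (x y z : A) :
  within A r x y -> within A r' y z -> within A (r + r') x z.
Proof.
elim: r' z => [|r' IH] z wxy /=; first by move->; rewrite addn0.
rewrite addnS => -[wyz|[u [wyu uz]]]; first by left; apply: IH.
by right; exists u; split=> //; apply: IH.
Qed.

Lemma within1 (x y : A) : gadj A x y -> within A 1 x y.
Proof. by move=> xy; right; exists x. Qed.

Lemma within_sym r (x y : A) : within A r x y -> within A r y x.
Proof.
elim: r x y => [|r IH] x y //= [wxy|[z [wxz zy]]]; first by left; apply: IH.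
exact: (within_trans (within1 (gadj_sym zy)) (IH _ _ wxz)).
Qed.

Lemma within_split r r' (x y : A) : within A (r + r') x y ->
  exists2 z, within A r x z & within A r' z y.
Proof.
elim: r' y => [|r' IH] y; first by rewrite addn0; exists y.
rewrite addnS => -[/IH[z wxz wzy]|[u [/IH[z wxz wzu] uy]]]; exists z => //.
  by left.
by right; exists u.
Qed.

Lemma within_rel (s : sym sg) (t : (ar s).-tuple A) (x y : A) :
  rel A s t -> x \in (t : seq A) -> y \in (t : seq A) -> within A 1 x y.
Proof.
move=> rt xt yt; have [->|/eqP xy] := eqVneq x y; first exact: within_refl.
by apply: within1; split=> //; exists s, t.
Qed.

End Within.

(** * Isomorphisms of spheres around families of points *)

(** Centres form a family over an arbitrary index type with a predicate selecting indices, so that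
    adjoining a point, passing to a cluster and renaming are all changes of index. *)
Definition nbh {sg} (A : structure sg) (K : Type) (r : nat) (X : K -> Prop)
    (p : K -> A) (x : A) : Prop :=
  exists2 k, X k & within A r (p k) x.

(** Both maps are total, but only their values on [P] and [Q] count. Carrying the inverse [g] makes
    the notion symmetric. *)
Definition partial_iso {sg} (A B : structure sg) (P : A -> Prop) (Q : B -> Prop)
    (h : A -> B) (g : B -> A) : Prop :=
  [/\ forall x, P x -> Q (h x) /\ g (h x) = x,
      forall y, Q y -> P (g y) /\ h (g y) = y &
      forall (s : sym sg) (t : (ar s).-tuple A),
        (forall x, x \in (t : seq A) -> P x) -> rel A s t = rel B s (map_tuple h t)].

Definition sphere_iso_by {sg} (A B : structure sg) (K : Type) (r : nat)
    (X : K -> Prop) (p : K -> A) (q : K -> B) (h : A -> B) (g : B -> A) : Prop :=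
  (forall k, X k -> h (p k) = q k) /\ partial_iso (nbh r X p) (nbh r X q) h g.

Definition fam_iso {sg} (A B : structure sg) (K : Type) (r : nat)
    (X : K -> Prop) (p : K -> A) (q : K -> B) : Prop :=
  exists h g, sphere_iso_by r X p q h g.

Section FamIso.
Variable sg : signature.
Implicit Types A B C : structure sg.

Lemma nbh_pt A (K : Type) r (X : K -> Prop) (p : K -> A) k : X k -> nbh r X p (p k).
Proof. by move=> Xk; exists k => //; apply: within_refl. Qed.

Lemma map_tuple_can_in (U V : eqType) (P : U -> Prop) (h : U -> V) (g : V -> U) n
    (t : n.-tuple U) : (forall x, P x -> g (h x) = x) ->
  (forall x, x \in (t : seq U) -> P x) -> map_tuple g (map_tuple h t) = t.
Proof.
move=> gh Pt; apply: val_inj => /=; rewrite -map_comp -[RHS]map_id.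
by apply/eq_in_map => x xt /=; apply/gh/Pt.
Qed.

Lemma partial_iso_sym A B (P : A -> Prop) (Q : B -> Prop) h g :
  partial_iso P Q h g -> partial_iso Q P g h.
Proof.
case=> hP gQ hrel; split=> // s t Qt.
rewrite hrel => [|x]; last by case/mapP=> y yt ->; apply: (gQ y (Qt y yt)).1.
by rewrite (@map_tuple_can_in _ _ Q) // => y /gQ[].
Qed.

Lemma sphere_iso_by_sym A B (K : Type) r (X : K -> Prop) (p : K -> A) (q : K -> B) h g :
  sphere_iso_by r X p q h g -> sphere_iso_by r X q p g h.
Proof.
move=> [hp iso]; split; last exact: partial_iso_sym.
by move=> k Xk; rewrite -hp //; case: iso => /(_ (p k) (nbh_pt r p Xk))[].
Qed.

Lemma fam_iso_sym A B (K : Type) r (X : K -> Prop) (p : K -> A) (q : K -> B) :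
  fam_iso r X p q -> fam_iso r X q p.
Proof. by move=> [h [g /sphere_iso_by_sym]]; exists g, h. Qed.

Lemma fam_iso_refl A (K : Type) r (X : K -> Prop) (p : K -> A) : fam_iso r X p p.
Proof.
exists id, id; split=> //; split=> // s t _; congr rel.
by apply: val_inj => /=; rewrite map_id.
Qed.

Lemma fam_iso_trans A B C (K : Type) r (X : K -> Prop) (p : K -> A) (q : K -> B)
    (o : K -> C) : fam_iso r X p q -> fam_iso r X q o -> fam_iso r X p o.
Proof.
move=> [h [g [hp [hP gQ hrel]]]] [h' [g' [hp' [hP' gQ' hrel']]]].
exists (h' \o h), (g \o g'); split; first by move=> k Xk /=; rewrite hp // hp'.
split=> [x /hP[/hP'[Ox e'] e]|y /gQ'[/gQ[Px e] e']|s t Pt] /=.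
- by rewrite e' e.
- by rewrite e e'.
rewrite hrel // hrel' => [|y /mapP[x xt ->]]; last exact: (hP x (Pt x xt)).1.
by congr rel; apply: val_inj => /=; rewrite -map_comp.
Qed.

Lemma fam_iso_eq A B (K : Type) r (X : K -> Prop) (p p' : K -> A) (q q' : K -> B) :
  p =1 p' -> q =1 q' -> fam_iso r X p q -> fam_iso r X p' q'.
Proof. by move=> /funext-> /funext->. Qed.

(** Every tuple witnessing an edge of the path from [y] to [x] lies entirely in the [r]-ball,
    because its entries are within [n + j] of a centre; so the path is transported edge by edge. *)
Lemma sphere_iso_within A B (K : Type) r (X : K -> Prop) (p : K -> A) (q : K -> B)
    h g n j y x :
  sphere_iso_by r X p q h g -> nbh n X p y -> n + j <= r ->
  within A j y x -> within B j (h y) (h x).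
Proof.
move=> [_ [hP _ hrel]] [k Xk wy]; elim: j x => [|j IH] x le_r /=; first by move->.
move=> [wx|[z [wyz [zx [s [t [rt [zt xt]]]]]]]]; first by left; apply: IH => //; lia.
have Pt u : u \in (t : seq A) -> nbh r X p u.
  move=> ut; exists k => //; apply: within_mono le_r _; rewrite -addn1 addnA.
  exact: within_trans (within_trans wy wyz) (within_rel rt zt ut).
right; exists (h z); split; first by apply: IH => //; lia.
split; last by exists s, (map_tuple h t); rewrite -hrel // !map_f.
by move=> e; apply: zx; rewrite -(hP z (Pt z zt)).2 -(hP x (Pt x xt)).2 e.
Qed.

Lemma sphere_iso_nbh A B (K : Type) r (X : K -> Prop) (p : K -> A) (q : K -> B)
    h g n x :
  sphere_iso_by r X p q h g -> n <= r -> nbh n X p x -> nbh n X q (h x).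
Proof.
move=> iso le_n [k Xk wx]; exists k => //; rewrite -iso.1 //.
by apply: (@sphere_iso_within _ _ _ _ _ _ _ _ _ 0) iso _ _ wx; first exists k.
Qed.

Lemma nbh_trans A (K K' : Type) n r (X : K -> Prop) (X' : K' -> Prop)
    (p : K -> A) (u : K' -> A) x :
  (forall k, X' k -> nbh n X p (u k)) -> nbh r X' u x -> nbh (n + r) X p x.
Proof.
move=> near [k /near[l Xl wl] wk]; exists l => //; exact: within_trans wl wk.
Qed.

Lemma nbh_mono A (K : Type) n r (X : K -> Prop) (p : K -> A) x :
  n <= r -> nbh n X p x -> nbh r X p x.
Proof. by move=> le [k Xk w]; exists k => //; apply: within_mono w. Qed.

(** The same two maps serve any centres close enough to the old ones for the new balls to fit into
    the old. Distances from the centres are kept in both directions, so new balls go onto new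
    balls. *)
Lemma sphere_iso_by_shift A B (K K' : Type) R r n (X : K -> Prop) (X' : K' -> Prop)
    (p : K -> A) (q : K -> B) (u : K' -> A) (v : K' -> B) h g :
  sphere_iso_by R X p q h g -> n + r <= R ->
  (forall k, X' k -> nbh n X p (u k)) -> (forall k, X' k -> h (u k) = v k) ->
  sphere_iso_by r X' u v h g.
Proof.
move=> iso le_R near huv; split=> //.
have nearP x : nbh r X' u x -> nbh R X p x.
  by move=> /(nbh_trans near); apply: nbh_mono.
have near' k : X' k -> nbh n X q (v k).
  move=> X'k; rewrite -huv //; apply: sphere_iso_nbh iso _ (near k X'k); lia.
have nearQ y : nbh r X' v y -> nbh R X q y.
  by move=> /(nbh_trans near'); apply: nbh_mono.
have [hp [hP gQ hrel]] := iso.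
have guv k : X' k -> g (v k) = u k.
  by move=> X'k; rewrite -huv //; apply: (hP _ _).2; apply/nearP/nbh_pt.
split.
- move=> x Px; split; last exact: (hP x (nearP x Px)).2.
  case: Px => k X'k wx; exists k => //; rewrite -huv //.
  exact: sphere_iso_within iso (near k X'k) le_R wx.
- move=> y Qy; split; last exact: (gQ y (nearQ y Qy)).2.
  case: Qy => k X'k wx; exists k => //; rewrite -guv //.
  exact: sphere_iso_within (sphere_iso_by_sym iso) (near' k X'k) le_R wx.
- by move=> s t Pt; apply: hrel => x /Pt/nearP.
Qed.

Lemma fam_iso_sub A B (K K' : Type) R r (X : K -> Prop) (X' : K' -> Prop)
    (f : K' -> K) (p : K -> A) (q : K -> B) :
  r <= R -> (forall k, X' k -> X (f k)) -> fam_iso R X p q ->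
  fam_iso r X' (p \o f) (q \o f).
Proof.
move=> le_R XX [h [g iso]]; exists h, g.
apply: (sphere_iso_by_shift (n := 0) iso) => // k /XX Xk.
  exact: nbh_pt.
exact: iso.1.
Qed.

(** Cutting the path at its midpoint leaves two halves, each inside a [d]-ball; hence radius [d]
    controls distance [2d]. *)
Lemma fam_iso_dist A B (K : Type) r d (X : K -> Prop) (p : K -> A) (q : K -> B) k l :
  fam_iso r X p q -> d <= r -> X k -> X l ->
  within A (d + d) (p k) (p l) -> within B (d + d) (q k) (q l).
Proof.
move=> [h [g iso]] le_r Xk Xl /within_split[z wkz /within_sym wlz].
have wz m : X m -> within A d (p m) z -> within B d (q m) (h z).
  move=> Xm; rewrite -(iso.1 m) //.
  by apply: (@sphere_iso_within _ _ _ _ _ _ _ _ _ 0) iso _ _ => //; apply: nbh_pt.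
exact: within_trans (wz _ Xk wkz) (within_sym (wz _ Xl wlz)).
Qed.

(** At separation greater than [2r + 1], the [r]-balls of different colours are disjoint and no
    tuple of a relation meets two of them, so the isomorphisms of the single colours unite to
    one. *)
Lemma fam_iso_glue A B (K C : Type) r (col : K -> C) (c0 : C) (p : K -> A) (q : K -> B) :
  (forall c, fam_iso r (fun k => col k = c) p q) ->
  (forall k l, within A (r + r).+1 (p k) (p l) -> col k = col l) ->
  (forall k l, within B (r + r).+1 (q k) (q l) -> col k = col l) ->
  fam_iso r (fun _ => True) p q.
Proof.
move=> isos sepA sepB.
have [h /choice[g iso]] := choice isos.
(* A point takes the colour of a centre within [r]; by separation all such centres agree. Outside
   the balls [c0] is a filler. *)
pose cA x := if pselect (exists k, within A r (p k) x) is left ex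
  then col (projT1 (cid ex)) else c0.
pose cB x := if pselect (exists k, within B r (q k) x) is left ex
  then col (projT1 (cid ex)) else c0.
have cAE k x : within A r (p k) x -> cA x = col k.
  rewrite /cA => wk; case: pselect => [ex|[]]; last by exists k.
  case: cid => l wl /=; apply: sepA; rewrite -addn1 -addnA addn1.
  by apply: within_trans wl (within_mono (leqnSn r) (within_sym wk)).
have cBE k x : within B r (q k) x -> cB x = col k.
  rewrite /cB => wk; case: pselect => [ex|[]]; last by exists k.
  case: cid => l wl /=; apply: sepB; rewrite -addn1 -addnA addn1.
  by apply: within_trans wl (within_mono (leqnSn r) (within_sym wk)).
have hE x : nbh r (fun=> True) p x ->
    nbh r (fun k => col k = cA x) p x /\ cB (h (cA x) x) = cA x.
  case=> k _ wk; have ck := cAE _ _ wk; have Pk : nbh r (fun k => col k = cA x) p x.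
    by exists k.
  split=> //; case: (iso (cA x)) => _ [/(_ x Pk)[[l cl wl] _] _ _].
  by rewrite (cBE l).
have gE y : nbh r (fun=> True) q y ->
    nbh r (fun k => col k = cB y) q y /\ cA (g (cB y) y) = cB y.
  case=> k _ wk; have ck := cBE _ _ wk; have Pk : nbh r (fun k => col k = cB y) q y.
    by exists k.
  split=> //; case: (iso (cB y)) => _ [_ /(_ y Pk)[[l cl wl] _] _].
  by rewrite (cAE l).
have forget D (S : structure sg) (o : K -> S) x :
    nbh r (D : K -> Prop) o x -> nbh r (fun=> True) o x.
  by case=> k _ wk; exists k.
exists (fun x => h (cA x) x), (fun y => g (cB y) y); split.
  move=> k _; rewrite (cAE k); last exact: within_refl.
  exact: (iso _).1.
split.
- move=> x Px; have [Pc e] := hE x Px; rewrite e.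
  by have [_ [/(_ x Pc)[Qx ->] _ _]] := iso (cA x); split=> //; apply: forget Qx.
- move=> y Qy; have [Qc e] := gE y Qy; rewrite e.
  by have [_ [_ /(_ y Qc)[Px ->] _]] := iso (cB y); split=> //; apply: forget Px.
move=> s t Pt.
have same c : (forall x, x \in (t : seq A) -> cA x = c) ->
    rel A s t = rel B s (map_tuple (fun x => h (cA x) x) t).
  move=> tc; have [_ [_ _ ->]] := iso c.
    by congr rel; apply: val_inj; apply/eq_in_map => x /tc->.
  by move=> x xt; rewrite -(tc x xt); apply: (hE x (Pt x xt)).1.
(* An empty tuple has no entry to supply a colour; the isomorphism of colour [c0] settles nullary
   relations. *)
have [t0|[z zt]] : (t : seq A) = [::] \/ exists z, z \in (t : seq A).
- by case: (t : seq A) => [|z u]; [left | right; exists z; rewrite mem_head].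
- by apply: (same c0) => x; rewrite t0.
apply/idP/idP => rt.
  rewrite -(same (cA z)) // => x xt; have [k _ wk] := Pt x xt; have [l _ wl] := Pt z zt.
  rewrite (cAE _ _ wk) (cAE _ _ wl); apply: sepA.
  rewrite -addn1 -addnA; apply: within_trans wk _; rewrite addnC.
  exact: within_trans (within_rel rt xt zt) (within_sym wl).
rewrite (same (cA z)) // => x xt.
have [Px <-] := hE x (Pt x xt); have [Pz <-] := hE z (Pt z zt).
have [_ [/(_ x Px)[[k ck wk] _] _ _]] := iso (cA x).
have [_ [/(_ z Pz)[[l cl wl] _] _ _]] := iso (cA z).
rewrite (cBE _ _ wk) (cBE _ _ wl); apply: sepB.
rewrite -addn1 -addnA; apply: within_trans wk _; rewrite addnC.
by apply: within_trans (within_rel rt _ _) (within_sym wl); apply/mapP;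
  [exists x | exists z].
Qed.

End FamIso.

(** * Equivalence of families, and counting by classes *)

(** The index [None] of [option K] carries the extra point whose sphere is taken jointly with the
    family. *)
Definition fam_equiv {sg} (A B : structure sg) (K : Type) (r : nat) (X : K -> Prop)
    (p : K -> A) (q : K -> B) : Prop :=
  exists2 f : A -> B, bijective f &
    forall x, fam_iso r (oapp X True) (oapp p x) (oapp q (f x)).

Lemma fam_equiv_sym sg (A B : structure sg) (K : Type) r (X : K -> Prop)
    (p : K -> A) (q : K -> B) : fam_equiv r X p q -> fam_equiv r X q p.
Proof.
move=> [f [g fK gK] iso]; exists g; first by exists f.
by move=> y; apply: fam_iso_sym; rewrite -{2}(gK y).
Qed.

Lemma fam_equiv_sub sg (A B : structure sg) (K K' : Type) R r (X : K -> Prop)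
    (X' : K' -> Prop) (s : K' -> K) (p : K -> A) (q : K -> B) :
  r <= R -> (forall k, X' k -> X (s k)) -> fam_equiv R X p q ->
  fam_equiv r X' (p \o s) (q \o s).
Proof.
move=> le_R XX [f bij_f iso]; exists f => // x.
apply: fam_iso_eq (fam_iso_sub (f := omap s) le_R _ (iso x)); by case.
Qed.

(** Induction on [#|W|], removing the class of one element at a time. Classes live in the sum type,
    so their representative may come from either side. *)
Lemma card_eq_by_classes (X Y : finType) (E : X + Y -> X + Y -> bool) (W : {set X + Y}) :
  reflexive E -> symmetric E -> transitive E ->
  (forall z, z \in W -> #|[set x | (inl x \in W) && E z (inl x)]| =
                       #|[set y | (inr y \in W) && E z (inr y)]|) ->
  #|[set x | inl x \in W]| = #|[set y | inr y \in W]|.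
Proof.
move=> Er Es Et; have [n] := ubnP #|W|; elim: n W => // n IH W ltW cls.
have [->|[z zW]] := set_0Vmem W.
  by rewrite !(eq_card0 (A := [set _ | _])) // => x; rewrite !inE.
pose W' := [set z' in W | ~~ E z z'].
have W'card : #|[set x | inl x \in W']| = #|[set y | inr y \in W']|.
  apply: IH.
    rewrite -ltnS; apply: leq_trans ltW; rewrite ltnS; apply: proper_card.
    apply/properP; split; first by apply/subsetP => z'; rewrite inE => /andP[].
    by exists z => //; rewrite inE Er andbF.
  move=> z'; rewrite inE => /andP[z'W nzz'].
  have sep u : E z' u -> ~~ E z u.
    by move=> z'u; apply: contra nzz' => zu; apply: Et zu _; rewrite Es.
  rewrite [LHS](_ : _ = #|[set x | (inl x \in W) && E z' (inl x)]|).
    rewrite cls //; apply: eq_card => y; rewrite !inE.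
    by case: (boolP (E z' _)) => [/sep->|]; rewrite ?andbT ?andbF.
  apply: eq_card => y; rewrite !inE.
  by case: (boolP (E z' _)) => [/sep->|]; rewrite ?andbT ?andbF.
rewrite -(cardsID [set x | E z (inl x)]) -[RHS](cardsID [set y | E z (inr y)]).
congr (_ + _).
  transitivity #|[set x | (inl x \in W) && E z (inl x)]|.
    by apply: eq_card => x; rewrite !inE.
  by rewrite cls //; apply: eq_card => x; rewrite !inE.
transitivity #|[set x | inl x \in W']|.
  by apply: eq_card => x; rewrite !inE andbC.
by rewrite W'card; apply: eq_card => x; rewrite !inE andbC.
Qed.

(** * Clusters of a tuple *)

Section Clusters.
Variables (sg : signature) (K : finType) (F : pred K) (r : nat).
Implicit Types A B S : structure sg.

(* Blocks of points more than [4r+2] apart have disjoint [(2r+1)]-neighbourhoods,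
   so an extra point within [2r+1] of the tuple belongs to a single block. *)
Definition linked S (p : K -> S) (k l : K) : bool :=
  (F k && F l) || `[< within S ((2 * r).+1 + (2 * r).+1) (p k) (p l) >].

Lemma linked_sym S (p : K -> S) : symmetric (linked p).
Proof.
move=> k l; rewrite /linked andbC; congr (_ || _).
by apply: asbool_equiv_eq; split=> /within_sym.
Qed.

Definition clustered S (p : K -> S) : K -> K -> bool := connect (linked p).

Lemma clustered_sym S (p : K -> S) : symmetric (clustered p).
Proof. exact/sym_connect_sym/linked_sym. Qed.

(** Each cluster of the reference tuple [s] is reproduced separately; different clusters may still
    interact in [p]. The radius [3r + 1] is [(2r + 1) + r]: it holds the [r]-spheres of all points
    within [2r + 1] of the cluster. *)
Definition weak_type S S' (s : K -> S) (p : K -> S') : Prop :=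
  forall k, fam_iso (3 * r).+1 (clustered s k) s p.

Definition same_type S S' (s : K -> S) (p : K -> S') : Prop :=
  weak_type s p /\ forall k l, linked p k l -> clustered s k l.

(** The linking distance is twice [2r + 1], and [2r + 1] does not exceed [3r + 1], so [fam_iso_dist]
    applies inside the cluster. *)
Lemma weak_type_linked S S' (s : K -> S) (p : K -> S') k l :
  weak_type s p -> linked s k l -> linked p k l.
Proof.
move=> /(_ k) iso skl; have ckl : clustered s k l by apply: connect1.
move: skl; rewrite /linked => /orP[->//|/asboolP wkl]; apply/orP; right.
apply/asboolP; apply: fam_iso_dist iso _ _ _ wkl => //; first lia.
exact: connect0.
Qed.

Lemma weak_type_clustered S S' (s : K -> S) (p : K -> S') k l :
  weak_type s p -> clustered s k l -> clustered p k l.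
Proof.
move=> wt; apply: connect_sub => {}k {}l skl.
exact/connect1/(weak_type_linked wt).
Qed.

Lemma same_type_clustered S S' (s : K -> S) (p : K -> S') :
  same_type s p -> clustered s =2 clustered p.
Proof.
move=> [wt sub] k l; apply/idP/idP; first exact: weak_type_clustered.
by apply: connect_sub => {}k {}l /sub.
Qed.

Lemma same_type_refl S (s : K -> S) : same_type s s.
Proof. by split=> [k|k l]; [exact: fam_iso_refl | exact: connect1]. Qed.

Lemma same_type_sym S S' (s : K -> S) (p : K -> S') : same_type s p -> same_type p s.
Proof.
move=> st; have ce := same_type_clustered st; case: st => wt sub; split=> [k|k l skl].
  apply: fam_iso_sym; move: (wt k); congr fam_iso.
  by apply: funext => l; rewrite ce.
by rewrite -ce; apply: connect1.
Qed.

Lemma weak_same_trans S1 S2 S3 (s1 : K -> S1) (s2 : K -> S2) (s3 : K -> S3) :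
  weak_type s1 s2 -> same_type s2 s3 -> weak_type s1 s3.
Proof.
move=> wt [wt' _] k; apply: fam_iso_trans (wt k) _.
apply: (fam_iso_sub (f := id)) (wt' k) => // l.
exact: weak_type_clustered.
Qed.

Lemma same_type_trans S1 S2 S3 (s1 : K -> S1) (s2 : K -> S2) (s3 : K -> S3) :
  same_type s1 s2 -> same_type s2 s3 -> same_type s1 s3.
Proof.
move=> st st'; split; first exact: weak_same_trans st.1 st'.
by move=> k l /st'.2; rewrite -(same_type_clustered st).
Qed.

(** A step into a point outside [F] costs at most [4r + 2]; at a point of [F] the estimate restarts
    from that point. *)
Lemma linked_path_near S (p : K -> S) k w : path (linked p) k w ->
  exists2 l, F l \/ l = k &
    within S (count (predC F) w * ((2 * r).+1 + (2 * r).+1)) (p l) (p (last k w)).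
Proof.
elim/last_ind: w => [|w z IH] /=; first by exists k => //; right.
rewrite rcons_path last_rcons => /andP[/IH[l lFk wl] lz].
have [Fz|nFz] := boolP (F z); first by exists z; [left | exact: within_refl].
exists l => //; rewrite -cats1 count_cat /= nFz addn0 mulnDl mul1n.
apply: within_trans wl _.
by move: lz; rewrite /linked (negPf nFz) andbF => /asboolP.
Qed.

(** A path without repetitions visits each added point at most once, which bounds the cost by their
    number. *)
Lemma clustered_near S (p : K -> S) k l : clustered p k l ->
  exists2 m, F m \/ m = k &
    within S (#|predC F| * ((2 * r).+1 + (2 * r).+1)) (p m) (p l).
Proof.
case/connectP=> w /shortenP[w' pw' uw' _] ->.
have [m mFk wm] := linked_path_near pw'; exists m => //.
apply: within_mono wm; rewrite leq_mul2r; apply/orP; right.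
rewrite -size_filter cardE; apply: uniq_leq_size.
  by rewrite filter_uniq //; case/andP: uw'.
by move=> z; rewrite mem_filter mem_enum => /andP[].
Qed.

(** A representative depending only on the block, so that a single sphere isomorphism moves the
    whole block. *)
Definition anchor S (s : K -> S) (k : K) : K :=
  odflt (root (linked s) k) [pick l | F l && clustered s k l].

Lemma anchor_clustered S (s : K -> S) k : clustered s k (anchor s k).
Proof.
by rewrite /anchor; case: pickP => [l /andP[]//|_]; apply: connect_root.
Qed.

Lemma anchor_eq S (s : K -> S) k l : clustered s k l -> anchor s k = anchor s l.
Proof.
move=> skl; rewrite /anchor (rootP (clustered_sym s) skl).
congr odflt; apply: eq_pick => m.
by rewrite /clustered (same_connect (clustered_sym s) skl).
Qed.

Definition extensions A (p0 : K -> A) (P : (K -> A) -> Prop) : {set {ffun K -> A}} :=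
  [set u : {ffun K -> A} | [forall k, F k ==> (u k == p0 k)] && `[< P u >]].

Lemma extensionsP A (p0 : K -> A) (P : (K -> A) -> Prop) (u : {ffun K -> A}) :
  reflect ((forall k, F k -> u k = p0 k) /\ P u) (u \in extensions p0 P).
Proof.
rewrite inE; apply: (iffP andP) => [[/forallP up0 /asboolP Pu]|[up0 Pu]]; split=> //.
- by move=> k /(implyP (up0 k))/eqP.
- by apply/forallP => k; apply/implyP => /up0/eqP.
- exact/asboolP.
Qed.

(* Each block lies in the sphere around the base tuple and the block's anchor, so
   transporting every block along the sphere isomorphism of its anchor is injective. *)
Lemma card_weak_type_le A B S (p0 : K -> A) (q0 : K -> B) (s : K -> S) R :
  #|predC F| * ((2 * r).+1 + (2 * r).+1) + (3 * r).+1 <= R ->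
  fam_equiv R F p0 q0 ->
  #|extensions p0 (weak_type s)| <= #|extensions q0 (weak_type s)|.
Proof.
move=> le_R [f bij_f /choice[h /choice[g iso]]].
pose G (u : {ffun K -> A}) := [ffun k => h (u (anchor s k)) (u k)].
have near (u : {ffun K -> A}) k : u \in extensions p0 (weak_type s) ->
    nbh (#|predC F| * ((2 * r).+1 + (2 * r).+1)) (oapp (fun k => F k : Prop) True)
        (oapp p0 (u (anchor s k))) (u k).
  case/extensionsP=> up0 wt.
  have ck : clustered u (anchor s k) k.
    by apply: weak_type_clustered wt _; rewrite clustered_sym anchor_clustered.
  have [m [Fm|->] wm] := clustered_near ck; last by exists None.
  by exists (Some m); rewrite //= -up0.
have hanchor (x : A) : h x x = f x by have [/(_ None)->] := iso x.
have GP u : u \in extensions p0 (weak_type s) -> G u \in extensions q0 (weak_type s).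
  move=> uP; have [up0 wt] := extensionsP _ _ _ uP; apply/extensionsP; split.
    move=> k Fk; rewrite ffunE (up0 k Fk).
    by have [/(_ (Some k) Fk)] := iso (u (anchor s k)).
  move=> k; apply: fam_iso_trans (wt k) _.
  exists (h (u (anchor s k))), (g (u (anchor s k))).
  apply: (sphere_iso_by_shift (iso (u (anchor s k))) le_R) => l /anchor_eq ->.
    exact: near.
  by rewrite ffunE.
rewrite -(card_in_imset (f := G)).
  by apply/subset_leq_card/subsetP => _ /imsetP[u uP ->]; apply: GP.
(* On anchors [G] acts as the bijection [f], so the anchors of [u] and [v] agree; their blocks are
   then moved by the same map, which [g] inverts on the sphere. *)
move=> u v uP vP eG.
have eqa k : u (anchor s k) = v (anchor s k).
  apply: (bij_inj bij_f); rewrite -!hanchor.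
  have /ffunP/(_ (anchor s k)) := eG.
  by rewrite !ffunE -(anchor_eq (anchor_clustered s k)).
apply/ffunP => k; have /ffunP/(_ k) := eG; rewrite !ffunE => e.
have [_ [hP _ _]] := iso (u (anchor s k)).
have hK (w : {ffun K -> A}) : w \in extensions p0 (weak_type s) ->
    w (anchor s k) = u (anchor s k) -> g (u (anchor s k)) (h (u (anchor s k)) (w k)) = w k.
  by move=> wP wa; apply: (hP _ _).2; rewrite -wa; apply: nbh_mono (near w k wP); lia.
by rewrite -(hK u uP) // -(hK v vP) // e eqa.
Qed.

(** Induction on the number of unclustered pairs of [s]. The tuples of weak but not exact type are
    sorted by their own exact types; each of them is a new reference tuple with strictly more
    clustered pairs, possibly in another structure. *)
Lemma card_same_type A B S (p0 : K -> A) (q0 : K -> B) (s : K -> S) R :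
  #|predC F| * ((2 * r).+1 + (2 * r).+1) + (3 * r).+1 <= R ->
  fam_equiv R F p0 q0 ->
  #|extensions p0 (same_type s)| = #|extensions q0 (same_type s)|.
Proof.
move=> le_R eqv.
have [n] := ubnP (#|{: K * K}| - #|[set kl | clustered s kl.1 kl.2]|).
elim: n => // n IH in S s *; rewrite ltnS => le_n.
have weakE : #|extensions p0 (weak_type s)| = #|extensions q0 (weak_type s)|.
  apply/eqP; rewrite eqn_leq !(@card_weak_type_le _ _ _ _ _ _ R) //.
  exact: fam_equiv_sym.
pose tup (z : {ffun K -> A} + {ffun K -> B}) : {T : structure sg & K -> T} :=
  match z with inl u => existT _ A (u : K -> A) | inr v => existT _ B (v : K -> B) end.
pose E z z' := `[< same_type (projT2 (tup z)) (projT2 (tup z')) >].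
pose W := [set z | match z with
  | inl u => u \in extensions p0 (weak_type s) :\: extensions p0 (same_type s)
  | inr v => v \in extensions q0 (weak_type s) :\: extensions q0 (same_type s) end].
have WE : #|[set u | inl u \in W]| = #|[set v | inr v \in W]|.
  apply: (@card_eq_by_classes _ _ E).
  - by move=> z; apply/asboolP/same_type_refl.
  - by move=> z z'; apply: asbool_equiv_eq; split=> /same_type_sym.
  - move=> z' z z'' /asboolP st /asboolP st'; apply/asboolP.
    exact: same_type_trans st st'.
  move=> z zW.
  have [wt nst] : weak_type s (projT2 (tup z)) /\ ~ same_type s (projT2 (tup z)).
    by case: z zW => u; rewrite !inE => /andP[nst /andP[up0 /asboolP wt]];
      move: nst; rewrite up0 => /asboolP.
  (* Among the discarded tuples, the class of [z] consists of all extensions of its exact type, so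
     the induction hypothesis counts it. *)
  have cls (C : structure sg) (c0 : K -> C) u : (u \in extensions c0 (weak_type s) :\:
      extensions c0 (same_type s)) && `[< same_type (projT2 (tup z)) u >] =
      (u \in extensions c0 (same_type (projT2 (tup z)))).
    rewrite !inE; case: [forall k, _] => //=; rewrite -asbool_neg -!asbool_and.
    apply: asbool_equiv_eq; split=> [[]//|st]; split=> //; split.
      by move=> st'; apply: nst; apply: same_type_trans st' (same_type_sym st).
    exact: weak_same_trans wt st.
  transitivity #|extensions p0 (same_type (projT2 (tup z)))|.
    by apply: eq_card => u; rewrite -cls !inE.
  rewrite IH; first by apply: eq_card => u; rewrite -cls !inE.
  suff lt_card : #|[set kl | clustered s kl.1 kl.2]| <
                 #|[set kl | clustered (projT2 (tup z)) kl.1 kl.2]|.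
    apply: leq_trans le_n; apply: ltn_sub2l => //.
    exact: leq_trans lt_card (max_card _).
  apply: proper_card; apply/properP; split.
    by apply/subsetP => kl; rewrite !inE; apply: weak_type_clustered.
  (* Failing the exact type, [z] links some pair that [s] does not cluster; this makes the inclusion
     strict. *)
  apply: contrapT => all_s; apply: nst; split=> // k l zkl.
  apply: contrapT => /negP nskl; apply: all_s.
  by exists (k, l); rewrite inE //; apply: connect1.
have sub (C : structure sg) (c0 : K -> C) :
    extensions c0 (same_type s) \subset extensions c0 (weak_type s).
  by apply/subsetP => u /extensionsP[uc [wt _]]; apply/extensionsP.
have := cardsID (extensions p0 (same_type s)) (extensions p0 (weak_type s)).
have := cardsID (extensions q0 (same_type s)) (extensions q0 (weak_type s)).
rewrite !(setIidPr (sub _ _)) weakE => <-.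
rewrite (_ : #|_ :\: extensions p0 _| = #|[set u | inl u \in W]|); last first.
  by apply: eq_card => u; rewrite !inE.
rewrite (_ : #|_ :\: extensions q0 _| = #|[set u | inr u \in W]|); last first.
  by apply: eq_card => u; rewrite !inE.
by rewrite WE => /addIn.
Qed.
End Clusters.

(** * Correcting a bijection near the tuples *)

(** For each [x0] in [N], the values at [x0] and at the preimage [u] of [H x0] are swapped. The
    first hypothesis allows the value that [u] receives, and injectivity of [H] keeps [u] away from
    points already corrected. *)
Lemma bijection_extending (X Y : finType) (E : X -> Y -> Prop) (N : pred X) (H f : X -> Y) :
  (forall x x' y y', E x y -> E x' y -> E x' y' -> E x y') ->
  bijective f -> (forall x, E x (f x)) ->
  (forall x, N x -> E x (H x)) -> {in N &, injective H} ->
  exists f', [/\ bijective f', forall x, E x (f' x) & {in N, f' =1 H}].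
Proof.
move=> difun bij_f Ef EH injH.
suff [f' [bij' E' agree]] : exists f', [/\ bijective f', forall x, E x (f' x) &
    {in enum N, f' =1 H}].
  by exists f'; split=> // x Nx; apply: agree; rewrite mem_enum.
have : {subset enum N <= N} by move=> x; rewrite mem_enum.
elim: (enum N) (enum_uniq N) => [|x0 w IH] /=; first by exists f.
move=> /andP[x0w uw] subN.
have [|f' [bij' E' agree]] := IH uw; first by move=> x xw; rewrite subN // inE xw orbT.
have [f'' f''K f'K] := bij'.
have Nx0 : x0 \in N by rewrite subN // mem_head.
pose u := f'' (H x0).
exists (f' \o tperm x0 u); split.
- exact: bij_comp bij' (injF_bij (@perm_inj _ _)).
- move=> x /=; case: tpermP => [->|->|//]; first by rewrite f'K; apply: EH.
  by apply: (difun u x0 (H x0)) => //; [move: (E' u); rewrite f'K | apply: EH].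
- move=> x; rewrite inE => /orP[/eqP->|xw] /=; first by rewrite tpermL f'K.
  have xx0 : x0 != x by apply: contraNneq x0w => ->.
  rewrite tpermD ?agree //; apply: contraNneq xx0 => ux.
  apply/eqP; apply: injH => //; first by rewrite subN // inE xw orbT.
  by rewrite -[LHS]f'K -/u ux agree.
Qed.

(** Within [2r + 1] of the tuple the bijection has to follow the cluster isomorphisms; elsewhere it
    only has to preserve single [r]-spheres. Any extra point is then glued to its block or treated
    as a block of its own. *)
Lemma same_type_equiv sg (A B : structure sg) (K : finType) (F : pred K) r
    (p : K -> A) (q : K -> B) (f : A -> B) :
  same_type F r p q -> bijective f ->
  (forall x, fam_iso r (fun=> True) (fun _ : unit => x) (fun=> f x)) ->
  fam_equiv r (fun=> True) p q.
Proof.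
move=> [/choice[h /choice[g iso]] sub] bij_f isof.
pose rt k := root (linked F r p) k.
have csym := clustered_sym F r p.
have rtE k l : linked F r p k l -> rt k = rt l.
  by move=> pkl; apply/(rootP csym)/connect1.
have rtc k : clustered F r p (rt k) k by rewrite csym; apply: connect_root.
have nearE k l x : within A (2 * r).+1 (p k) x -> within A (2 * r).+1 (p l) x -> rt k = rt l.
  move=> wk /within_sym wl; apply: rtE; apply/orP; right; apply/asboolP.
  exact: within_trans wk wl.
have near_q k l y : within B (2 * r).+1 (q k) y -> within B (2 * r).+1 (q l) y -> rt k = rt l.
  move=> wk /within_sym wl; apply/(rootP csym)/sub; apply/orP; right; apply/asboolP.
  exact: within_trans wk wl.
pose cl x := if pselect (exists k, within A (2 * r).+1 (p k) x) is left ex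
  then Some (rt (projT1 (cid ex))) else None.
have clE k x : within A (2 * r).+1 (p k) x -> cl x = Some (rt k).
  rewrite /cl => wk; case: pselect => [ex|[]]; last by exists k.
  by case: cid => l wl /=; congr Some; apply: nearE wl wk.
have clP m x : cl x = Some m -> exists2 k, m = rt k & within A (2 * r).+1 (p k) x.
  by rewrite /cl; case: pselect => // ex; case: cid => k wk [<-]; exists k.
(* The values of [H] are imposed only where [cl x] is a block; the branch [f x] is a filler. *)
pose H x := if cl x is Some m then h m x else f x.
have near_h k x : within A (2 * r).+1 (p k) x -> within B (2 * r).+1 (q k) (h (rt k) x).
  rewrite -((iso (rt k)).1 k) //.
  apply: (sphere_iso_within (n := 0) (iso (rt k))); last lia.
  exact: nbh_pt.
have near_g k y : within B (2 * r).+1 (q k) y -> within A (2 * r).+1 (p k) (g (rt k) y).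
  have iso' := sphere_iso_by_sym (iso (rt k)); rewrite -(iso'.1 k) //.
  by apply: (sphere_iso_within (n := 0) iso'); [exact: nbh_pt | lia].
have domA k x : within A (2 * r).+1 (p k) x -> nbh (3 * r).+1 (clustered F r p (rt k)) p x.
  by move=> wk; exists k => //; apply: within_mono wk; lia.
have domB k y : within B (2 * r).+1 (q k) y -> nbh (3 * r).+1 (clustered F r p (rt k)) q y.
  by move=> wk; exists k => //; apply: within_mono wk; lia.
have [] := @bijection_extending A B
  (fun x y => fam_iso r (fun=> True) (fun _ : unit => x) (fun=> y)) (fun x => cl x : bool) H f.
- move=> x x' y y' xy x'y x'y'; apply: fam_iso_trans xy _.
  exact: fam_iso_trans (fam_iso_sym x'y) x'y'.
- by [].
- by [].
- move=> x; rewrite /H; case e : (cl x) => [m|//] _; have [k -> wk] := clP _ _ e.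
  exists (h (rt k)), (g (rt k)).
  apply: (sphere_iso_by_shift (n := (2 * r).+1) (iso (rt k))) => //; first lia.
  by move=> _ _; exists k.
- move=> x x'; rewrite !unfold_in /H.
  case e : (cl x) => [m|//] _; case e' : (cl x') => [m'|//] _.
  have [k -> wk] := clP _ _ e; have [k' -> wk'] := clP _ _ e' => hxx.
  have rkk : rt k = rt k'.
    by apply: near_q (near_h _ _ wk) _; rewrite hxx; apply: near_h.
  have [_ [hP _ _]] := iso (rt k).
  by rewrite -(hP x (domA _ _ wk)).2 hxx rkk; case: (iso (rt k')) => _ [hP' _ _];
    rewrite (hP' x' (domA _ _ wk')).2.
move=> f' [bij' isof' f'H]; exists f' => // x.
have f'E m z : cl z = Some m -> f' z = h m z.
  by move=> e; rewrite f'H ?unfold_in /H e.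
(* Points far from [p] stay far from [q]: the cluster isomorphism already covers the ball around
   [q k], and [f'] is injective. *)
have f'near k : within B (2 * r).+1 (q k) (f' x) -> cl x = Some (rt k).
  move=> wk; have wg := near_g _ _ wk; rewrite -(clE _ _ wg); congr cl.
  apply: (bij_inj bij'); rewrite (f'E _ _ (clE _ _ wg)).
  by case: (iso (rt k)) => _ [_ gQ _]; rewrite (gQ _ (domB _ _ wk)).2.
have rr : (r + r).+1 = (2 * r).+1 by lia.
apply: (@fam_iso_sub _ _ _ _ _ r r (fun=> True) _ id (oapp p x) (oapp q (f' x))) => //.
(* Colours are blocks. The extra point has the colour of the block near it, or [None] when it is
   far; [(r + r).+1] is exactly the radius used by [cl]. *)
apply: (fam_iso_glue (col := oapp (Some \o rt) (cl x)) None) 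
  => [[m|]|[k|] [l|]|[k|] [l|]] //; rewrite ?rr; try move=> w.
- exists (h m), (g m).
  apply: (sphere_iso_by_shift (n := (2 * r).+1) (iso m)); first lia.
    by case=> [k [<-]|/clP[k -> wk]]; exists k => //; apply: within_refl.
  by case=> [k [<-]|/f'E] //=; apply: (iso _).1.
- have [h' [g' iso']] := isof' x; exists h', g'.
  apply: (sphere_iso_by_shift (n := 0) iso') => // -[//|_ /=]; last exact: (iso'.1 tt).
  by exists tt.
- by congr Some; have := nearE _ _ _ w (within_refl _ _).
- by rewrite /= (clE k).
- by rewrite /= (clE l) //; apply: within_sym.
- by congr Some; have := near_q _ _ _ w (within_refl _ _).
- exact/esym/f'near.
- exact/f'near/within_sym.
Qed.

(** * Answering several added points at once *)

Definition sum_fun (K J T : Type) (p : K -> T) (c : J -> T) (i : K + J) : T :=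
  match i with inl k => p k | inr j => c j end.

(** The tuple [c] itself shows that its type is realised over [p]; equal counts give a realisation
    over [q]. *)
Lemma fam_equiv_extend sg (A B : structure sg) (K J : finType) r R
    (p : K -> A) (q : K -> B) (c : J -> A) :
  #|J| * ((2 * r).+1 + (2 * r).+1) + (3 * r).+1 <= R ->
  fam_equiv R (fun=> True) p q ->
  exists d : J -> B, fam_equiv r (fun=> True) (sum_fun p c) (sum_fun q d).
Proof.
move=> le_R eqv.
pose F : pred (K + J) := fun i => if i is inl _ then true else false.
(* Only the values on [F] constrain [extensions], so [inh B] merely fills the added coordinates. *)
pose p0 := sum_fun p c; pose q0 := sum_fun q (fun _ : J => inh B).
have cardF : #|predC F| = #|J|.
  rewrite -(card_image (f := @inr K J)) => [|j j' [//]].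
  apply: eq_card => -[k|j]; rewrite !inE /=.
    by apply/esym/negbTE/imageP => -[].
  by apply/esym/imageP; exists j.
have eqvF : fam_equiv R F p0 q0.
  case: eqv => f bij_f iso; exists f => // x.
  have [h [g isox]] := iso x; exists h, g.
  apply: (sphere_iso_by_shift (n := 0) isox) => // -[[k|j]|] //= _.
  - by exists (Some k).
  - by exists None.
  - exact: (isox.1 (Some k)).
  - exact: (isox.1 None).
rewrite -cardF in le_R; have e := card_same_type p0 le_R eqvF.
have : 0 < #|extensions F q0 (same_type F r p0)|.
  rewrite -e; apply/card_gt0P; exists (finfun p0); apply/extensionsP.
  split=> [k _|]; first by rewrite ffunE.
  by rewrite (_ : (finfun p0 : _ -> _) = p0);
    [exact: same_type_refl | apply/funext => k; rewrite ffunE].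
case/card_gt0P=> v /extensionsP[vq st]; exists (fun j => v (inr j)).
have -> : sum_fun q (fun j => v (inr j)) = v.
  by apply/funext => -[k|j] //=; rewrite vq.
case: eqv => f bij_f iso; apply: (same_type_equiv st bij_f) => x.
apply: (fam_iso_sub (f := fun=> None)) (iso x) => //.
by apply: leq_trans le_R; lia.
Qed.

(** * Formulas *)

Scheme SigmaF_mut := Minimality for SigmaF Sort Prop
  with PiF_mut := Minimality for PiF Sort Prop.
Combined Scheme SigmaF_PiF_ind from SigmaF_mut, PiF_mut.

Section Formulas.
Variable sg : signature.
Implicit Types (A B : structure sg) (phi psi : formula sg).

Lemma sat_ext A phi (e e' : nat -> A) :
  (forall v, free_in v phi -> e v = e' v) -> sat A phi e <-> sat A phi e'.
Proof.
have upd psi x (u u' : nat -> A) a :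
    (forall v, (v != x) && free_in v psi -> u v = u' v) ->
    forall v, free_in v psi ->
      (if v == x then a else u v) = (if v == x then a else u' v).
  by move=> uu' v fv; case: eqVneq => // vx; apply: uu'; rewrite vx.
elim: phi e e' => [x y|s t|psi IH|psi1 IH1 psi2 IH2|psi1 IH1 psi2 IH2|x psi IH|x psi IH]
  e e' /= ee'.
- by rewrite !ee' ?eqxx ?orbT.
- suff -> : map_tuple e t = map_tuple e' t by [].
  by apply: val_inj; apply/eq_in_map => v vt; apply: ee'.
- by have [] := IH e e' ee'; tauto.
- have [] := IH1 e e'; first by move=> v fv; rewrite ee' ?fv.
  by have [] := IH2 e e'; [move=> v fv; rewrite ee' ?fv ?orbT | tauto].
- have [] := IH1 e e'; first by move=> v fv; rewrite ee' ?fv.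
  by have [] := IH2 e e'; [move=> v fv; rewrite ee' ?fv ?orbT | tauto].
- by have ih a := IH _ _ (upd psi x e e' a ee'); split=> -[a /ih]; exists a.
- by have ih a := IH _ _ (upd psi x e e' a ee'); split=> sa a; apply/ih.
Qed.

Lemma fam_iso_qfree A B (K : Type) r (p : K -> A) (q : K -> B) (e : nat -> K) phi :
  fam_iso r (fun=> True) p q -> qfree phi -> sat A phi (p \o e) <-> sat B phi (q \o e).
Proof.
move=> iso; have [h [g [hp [hP _ hrel]]]] := iso.
have [g' [h' [gq _]]] := fam_iso_sym iso.
elim: phi => [x y|s t|psi IH|psi1 IH1 psi2 IH2|psi1 IH1 psi2 IH2|//|//] /=.
- move=> _; split=> [pxy|qxy]; first by rewrite -!hp // pxy.
  by rewrite -!gq // qxy.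
- move=> _; rewrite hrel => [|_ /mapP[v _ ->]]; last exact: nbh_pt.
  suff -> : map_tuple h (map_tuple (p \o e) t) = map_tuple (q \o e) t by [].
  by apply: val_inj; rewrite /= -map_comp; apply: eq_map => v /=; apply: hp.
- by move=> /IH; tauto.
- by move=> /andP[/IH1 ? /IH2 ?]; tauto.
- by move=> /andP[/IH1 ? /IH2 ?]; tauto.
Qed.

Lemma fam_equiv_iso A B (K : Type) r (p : K -> A) (q : K -> B) :
  fam_equiv r (fun=> True) p q -> fam_iso r (fun=> True) p q.
Proof.
by case=> f _ /(_ (inh A)); apply: (fam_iso_sub (f := Some)).
Qed.

Lemma fam_equiv_reindex A B (K K' : Type) R r (s : K' -> K) (p : K -> A) (q : K -> B)
    (p' : K' -> A) (q' : K' -> B) :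
  r <= R -> p \o s =1 p' -> q \o s =1 q' -> fam_equiv R (fun=> True) p q ->
  fam_equiv r (fun=> True) p' q'.
Proof. by move=> le_r /funext<- /funext<-; apply: fam_equiv_sub. Qed.

Fixpoint nquant phi : nat :=
  match phi with
  | FEq _ _ | FRel _ _ => 0
  | FNot p => nquant p
  | FAnd p q | FOr p q => nquant p + nquant q
  | FEx _ p | FAll _ p => (nquant p).+1
  end.

(** A quantifier takes two symbols, and some atom adds at least one more. *)
Lemma nquant_flen phi : (nquant phi).*2 < flen phi.
Proof. by elim: phi => //=; try lia; move=> s _; case: (ar s). Qed.

(** Predicates instead of formulas allow a negated formula of [PiF] to be handled like one of
    [SigmaF]. The environment factors through a finite family whose index type may grow. *)
Definition local_query r (Q : forall A, (nat -> A) -> Prop) : Prop :=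
  forall A B (K : finType) (p : K -> A) (q : K -> B) (e : nat -> K),
    fam_equiv r (fun=> True) p q -> Q A (p \o e) -> Q B (q \o e).

(* All the existential choices that make [Q] true in [A] are collected in one
   tuple [c], so that [B] has to answer a whole quantifier block at once. *)
Definition witnessed r N (Q : forall A, (nat -> A) -> Prop) : Prop :=
  forall A (K : finType) (p : K -> A) (e : nat -> K), Q A (p \o e) ->
  exists (J : finType) (c : J -> A), #|J| <= N /\
    forall B (q : K -> B) (d : J -> B),
      fam_equiv r (fun=> True) (sum_fun p c) (sum_fun q d) -> Q B (q \o e).

Lemma witnessed_local r N Q : local_query r Q -> witnessed r N Q.
Proof.
move=> loc A K p e QA; exists void, (of_void A); rewrite card_void.
split=> // B q d eqv; apply: loc QA.
exact: (fam_equiv_reindex (s := inl) _ _ _ eqv).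
Qed.

Lemma witnessed_iff r N Q Q' : (forall A e, Q A e <-> Q' A e) ->
  witnessed r N Q -> witnessed r N Q'.
Proof.
move=> QQ' wit A K p e /QQ'/wit[J [c [cardJ tr]]]; exists J, c; split=> // B q d.
by move=> /tr/QQ'.
Qed.

(** The two witness tuples are put side by side, and each conjunct restricts the equivalence to its
    own. *)
Lemma witnessed_and r N1 N2 Q1 Q2 : witnessed r N1 Q1 -> witnessed r N2 Q2 ->
  witnessed r (N1 + N2) (fun A e => Q1 A e /\ Q2 A e).
Proof.
move=> wit1 wit2 A K p e [/wit1[J1 [c1 [le1 tr1]]] /wit2[J2 [c2 [le2 tr2]]]].
exists (J1 + J2)%type, (sum_fun c1 c2); rewrite card_sum; split; first exact: leq_add.
move=> B q d eqv; split.
  apply: (tr1 B q (d \o inl)).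
  by apply: (fam_equiv_reindex (s := sum_fun inl (inr \o inl)) _ _ _ eqv) => // -[].
apply: (tr2 B q (d \o inr)).
by apply: (fam_equiv_reindex (s := sum_fun inl (inr \o inr)) _ _ _ eqv) => // -[].
Qed.

Lemma witnessed_or r N1 N2 Q1 Q2 : witnessed r N1 Q1 -> witnessed r N2 Q2 ->
  witnessed r (N1 + N2) (fun A e => Q1 A e \/ Q2 A e).
Proof.
move=> wit1 wit2 A K p e [/wit1|/wit2] [J [c [le_J tr]]]; exists J, c;
  (split=> [|B q d /tr]; [lia | tauto]).
Qed.

Lemma witnessed_ex r N x Q : witnessed r N Q ->
  witnessed r N.+1 (fun A e => exists a, Q A (fun v => if v == x then a else e v)).
Proof.
(* The value of [x] becomes a new index [None], first in the base family so that [wit] applies, then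
   among the witnesses; the reindexing [s] passes between the two. *)
move=> wit A K p e [a]; pose e' v := if v == x then None else Some (e v).
have updE S (u : K -> S) (z : S) :
    (fun v => if v == x then z else (u \o e) v) = oapp u z \o e'.
  by apply: funext => v; rewrite /e' /=; case: eqP.
rewrite updE => /wit[J [c [le_J tr]]].
exists (option J), (oapp c a); rewrite card_option ltnS; split=> // B q d eqv.
exists (d None); rewrite updE; apply: (tr B _ (d \o Some)).
pose s (i : option K + J) : K + option J :=
  match i with inl o => oapp inl (inr None) o | inr j => inr (Some j) end.
by apply: (fam_equiv_reindex (s := s) _ _ _ eqv) => // -[[]|].
Qed.

Lemma level0_qfree :
  (forall n phi, SigmaF n phi -> n = 0 -> qfree phi) /\
  (forall n phi, PiF n phi -> n = 0 -> qfree phi).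
Proof.
apply: (@SigmaF_PiF_ind sg (fun n phi => n = 0 -> qfree phi)
                           (fun n phi => n = 0 -> qfree phi)) => //= n.
1,2,4,5: by move=> p q _ IHp _ IHq n0; rewrite IHp // IHq.
all: by move=> x p _ _; case: n.
Qed.

Lemma local_query_qfree r phi : qfree phi ->
  local_query r (fun A => sat A phi) /\ local_query r (fun A e => ~ sat A phi e).
Proof.
move=> qf; split=> A B K p q e /fam_equiv_iso iso;
  by have := fam_iso_qfree e iso qf; tauto.
Qed.

Section Step.
Variables (n r L : nat).
Hypothesis lower_local : forall phi, SigmaF n phi \/ PiF n phi -> flen phi <= L ->
  local_query r (fun A => sat A phi) /\ local_query r (fun A e => ~ sat A phi e).

(** Counterexamples to a [PiF] formula play the role of witnesses, so both classes run through one
    induction. Within a level only the number of witnesses grows; a subformula of the lower level is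
    local with the same [r] and adds none. *)
Lemma level_witnessed :
  (forall m phi, SigmaF m phi -> m = n.+1 -> flen phi <= L ->
     witnessed r (nquant phi) (fun A => sat A phi)) /\
  (forall m phi, PiF m phi -> m = n.+1 -> flen phi <= L ->
     witnessed r (nquant phi) (fun A e => ~ sat A phi e)).
Proof.
apply: (@SigmaF_PiF_ind sg
  (fun m phi => m = n.+1 -> flen phi <= L -> witnessed r (nquant phi) (fun A => sat A phi))
  (fun m phi => m = n.+1 -> flen phi <= L ->
     witnessed r (nquant phi) (fun A e => ~ sat A phi e))) => /=.
- by move=> m phi qf _ _; have [] := local_query_qfree r qf; move=> + _; apply: witnessed_local.
- move=> m phi piF _ [mn] le_L; rewrite mn in piF; apply: witnessed_local.
  by have [] := lower_local (or_intror piF).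
- move=> m phi _ IH mn le_L; exact: IH mn (ltnW le_L).
- move=> m p q _ IHp _ IHq mn le_L.
  by apply: witnessed_and; [apply: IHp | apply: IHq] => //; lia.
- move=> m p q _ IHp _ IHq mn le_L.
  by apply: witnessed_or; [apply: IHp | apply: IHq] => //; lia.
- move=> m x p _ IHp _ mn le_L.
  have wp : witnessed r (nquant p) (fun A => sat A p) by apply: IHp => //; lia.
  exact: (witnessed_ex (x := x) wp).
- by move=> m phi qf _ _; have [] := local_query_qfree r qf; move=> _; apply: witnessed_local.
- move=> m phi sF _ [mn] le_L; rewrite mn in sF; apply: witnessed_local.
  by have [] := lower_local (or_introl sF).
- move=> m phi _ IH mn le_L; apply: witnessed_iff (IH mn (ltnW le_L)) => A e.
  by rewrite notK.
- move=> m p q _ IHp _ IHq mn le_L.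
  have wp : witnessed r (nquant p) (fun A e => ~ sat A p e) by apply: IHp => //; lia.
  have wq : witnessed r (nquant q) (fun A e => ~ sat A q e) by apply: IHq => //; lia.
  apply: witnessed_iff (witnessed_or wp wq) => A e.
  by rewrite not_andE.
- move=> m p q _ IHp _ IHq mn le_L.
  have wp : witnessed r (nquant p) (fun A e => ~ sat A p e) by apply: IHp => //; lia.
  have wq : witnessed r (nquant q) (fun A e => ~ sat A q e) by apply: IHq => //; lia.
  apply: witnessed_iff (witnessed_and wp wq) => A e; tauto.
- move=> m x p _ IHp _ mn le_L.
  have wp : witnessed r (nquant p) (fun A e => ~ sat A p e) by apply: IHp => //; lia.
  apply: witnessed_iff (witnessed_ex (x := x) wp) => A e.
  by rewrite -existsNE.
Qed.

End Step.

Lemma witnessed_local_query r R N Q :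
  N * ((2 * r).+1 + (2 * r).+1) + (3 * r).+1 <= R -> witnessed r N Q -> local_query R Q.
Proof.
move=> le_R wit A B K p q e eqv /wit[J [c [le_J tr]]].
have [|d eqvd] := @fam_equiv_extend _ _ _ _ _ r R p q c _ eqv; last exact: tr eqvd.
by apply: leq_trans le_R; rewrite leq_add2r leq_mul2r le_J orbT.
Qed.

(** By symmetry of [fam_equiv], preservation in one direction is preservation in both. *)
Lemma local_query_not r Q :
  local_query r Q <-> local_query r (fun A e => ~ Q A e).
Proof.
split=> loc A B K p q e /fam_equiv_sym/loc imp.
  by apply: contra_not; apply: imp.
by move=> QA; apply: contrapT => /imp.
Qed.

Lemma level_local L n phi : SigmaF n phi \/ PiF n phi -> flen phi <= L ->
  local_query (L.*2.+1 ^ n).-1 (fun A => sat A phi) /\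
  local_query (L.*2.+1 ^ n).-1 (fun A e => ~ sat A phi e).
Proof.
elim: n phi => [|n IH] phi lev le_L.
  apply: local_query_qfree; have [sig0 pi0] := level0_qfree.
  by case: lev => [/sig0|/pi0]; apply.
(* With [k] quantifiers and [2k + 1 <= L], the required radius plus one is at most
   [(4k + 3)(r + 1)], hence at most [(2L + 1)(r + 1)]. *)
have le_R : nquant phi * ((2 * (L.*2.+1 ^ n).-1).+1 + (2 * (L.*2.+1 ^ n).-1).+1) +
    (3 * (L.*2.+1 ^ n).-1).+1 <= (L.*2.+1 ^ n.+1).-1.
  have := nquant_flen phi; rewrite expnS.
  have : 0 < L.*2.+1 ^ n by rewrite expn_gt0.
  case: (_ ^ n) => // r _ lt_L.
  have : ((nquant phi).*2.*2 + 3) * r.+1 <= L.*2.+1 * r.+1.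
    by rewrite leq_mul2r /=; lia.
  by move=> /=; lia.
have [sig pi] := level_witnessed IH.
case: lev => [/sig|/pi] /(_ erefl le_L)/(witnessed_local_query le_R) loc.
  by split=> //; move/local_query_not: loc.
split=> //; exact/(local_query_not _ (fun A => sat A phi)).
Qed.

End Formulas.

(** * From families back to lists, and the rank *)

Lemma sphere_iso_fam_iso sg (A B : structure sg) r m (a : seq A) (b : seq B) x y :
  size a = m -> size b = m -> sphere_iso A B r (rcons a x) (rcons b y) ->
  fam_iso r (oapp (fun=> True) True) (oapp (fun i : 'I_m => nth (inh A) a i) x)
    (oapp (fun i : 'I_m => nth (inh B) b i) y).
Proof.
move=> sa sb [h [hN hinj hsurj hab hrel]].
have inNE (S : structure sg) (c : seq S) z w : size c = m ->
    inN S r (rcons c z) w <->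
    nbh r (oapp (fun=> True) True) (oapp (fun i : 'I_m => nth (inh S) c i) z) w.
  move=> sc; split=> [[v [vc wv]]|[[i|] _ /= wv]].
  - move: vc; rewrite mem_rcons inE => /orP[/eqP vz|/(nthP (inh S))[i lt_i e]].
      by exists None; rewrite //= -vz.
    by rewrite sc in lt_i; exists (Some (Ordinal lt_i)); rewrite //= e.
  - exists (nth (inh S) c i); split=> //.
    by rewrite mem_rcons inE mem_nth ?orbT // sc.
  - by exists z; rewrite mem_rcons mem_head.
(* Surjectivity on spheres yields an inverse by choice; [inh A] fills the values off the sphere. *)
have [|g gP] := @choice _ _ (fun w z => inN B r (rcons b y) w ->
    inN A r (rcons a x) z /\ h z = w).
  move=> w.
  have [/hsurj[z]|nw] := pselect (inN B r (rcons b y) w); first by exists z.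
  by exists (inh A).
have /eqP := hab; rewrite map_rcons eqseq_rcons => /andP[/eqP ha /eqP hx].
exists h, g; split.
  by case=> [i|] _ //=; rewrite -ha (nth_map (inh A)) // sa.
split.
- move=> z /(inNE A) -/(_ sa) Nz; split; first by apply/inNE => //; apply: hN.
  by have [Ngz hgz] := gP _ (hN _ Nz); apply: hinj.
- move=> w /(inNE B) -/(_ sb) /gP[Nw ->]; split=> //; exact/inNE.
- move=> s t tN; apply/idP/idP => /hrel; apply; move=> z /tN/(inNE A); exact.
Qed.

Theorem theorem5p4 (sg : signature) (n : nat) (phi : formula sg) (xs : seq nat) :
  uniq xs -> 0 < size xs ->
  (forall v, free_in v phi -> v \in xs) ->
  SigmaF n phi ->
  exists r, is_lr phi xs r /\ r < (flen phi).*2.+1 ^ n.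
Proof.
move=> _ xs_gt0 fv sig; set R := _ ^ n.
have R_gt0 : 0 < R by rewrite expn_gt0.
have loc : hanf_local_with phi xs R.-1.
  move=> A B a b sa sb [f [bij_f iso]].
  (* Variables outside [xs] get the index 0, available as [xs] is non-empty; they are not free in
     [phi]. *)
  pose e v : 'I_(size xs) := insubd (Ordinal xs_gt0) (index v xs).
  have eqv : fam_equiv R.-1 (fun=> True) (fun i : 'I_(size xs) => nth (inh A) a i)
      (fun i : 'I_(size xs) => nth (inh B) b i).
    by exists f => // x; apply: sphere_iso_fam_iso.
  have envE S c : sat S phi (env S xs c) <->
      sat S phi ((fun i : 'I_(size xs) => nth (inh S) c i) \o e).
    by apply: sat_ext => v /fv vxs; rewrite /env /= insubdK // unfold_in index_mem.
  have [pos _] := level_local (or_introl sig) (leqnn _).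
  split=> /envE sat_phi; apply/envE; first exact: pos eqv sat_phi.
  exact: pos (fam_equiv_sym eqv) sat_phi.
have ex : exists r, `[< hanf_local_with phi xs r >] by exists R.-1; apply/asboolP.
case: (ex_minnP ex) => r /asboolP loc_r min_r; exists r; split.
  by split=> // r' lt_r' /asboolP/min_r; rewrite leqNgt lt_r'.
by rewrite -(prednK R_gt0) ltnS; apply/min_r/asboolP.
Qed.
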